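(* Let $\mathfrak g^{\mathbb C}$ be a finite-dimensional complex Lie algebra and $g^{\mathbb C}$ a holomorphic inner product on $\mathfrak g^{\mathbb C}$. Let $\mathfrak g\subset\mathfrak g^{\mathbb C}$ be a real form (of Lie algebras) which is a real slice, and let $(p,q)$ be the signature of $g:=g^{\mathbb C}|_{\mathfrak g}$. Then any two Cartan involutions of $\mathfrak g$ (with respect to $g$) are conjugate in $\mathrm{Aut}(\mathfrak g)_0\cap O(p,q)_0$.
   Context: A holomorphic inner product is a symmetric non-degenerate complex bilinear form. $\mathfrak g$ is a real slice if $g^{\mathbb C}|_{\mathfrak g}$ is real valued and non-degenerate. $O(p,q)$ denotes the isometry group of $(\mathfrak g,g)$, $\mathrm{Aut}(\mathfrak g)$ the group of Lie algebra automorphisms of $\mathfrak g$, and a subscript $0$ denotes the identity component. A Cartan involution of $\mathfrak g$ (with respect to $g$) is a Lie algebra homomorphism $\theta:\mathfrak g\to\mathfrak g$ with $\theta^2=1$ (the identity is allowed), which is an isometry of $g$, and such that $g(\cdot,\theta(\cdot))$ is positive definite. *)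

(* Defs.v *)
From HB Require Import structures.
From mathcomp Require Import all_boot all_order all_algebra.
From mathcomp Require Import all_classical all_reals all_analysis.
From mathcomp Require Import complex.
Set Implicit Arguments. Unset Strict Implicit. Unset Printing Implicit Defensive.
Import Order.TTheory GRing.Theory Num.Theory passmx.
Import numFieldNormedType.Exports.
Local Open Scope classical_set_scope.
Local Open Scope ring_scope.
Local Open Scope complex_scope.

(* The real vector space underlying a complex one: same elements, scalars
   restricted along R -> R[i]. *)
Definition realify (R : realType) (L : vectType R[i]) : Type := L.

Section Realify.
Variables (R : realType) (L : vectType R[i]).

HB.instance Definition _ := GRing.Zmodule.on (realify L).

Definition rscale (r : R) (v : realify L) : realify L := r%:C *: (v : L).

Fact rscaleA a b v : rscale a (rscale b v) = rscale (a * b) v.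
Proof. by rewrite /rscale scalerA -rmorphM. Qed.
Fact rscale1 : left_id 1 rscale.
Proof. by move=> v; rewrite /rscale rmorph1 scale1r. Qed.
Fact rscaleDr : right_distributive rscale +%R.
Proof. by move=> a u v; rewrite /rscale scalerDr. Qed.
Fact rscaleDl v : {morph rscale^~ v : a b / a + b}.
Proof. by move=> a b; rewrite /rscale rmorphD scalerDl. Qed.

HB.instance Definition _ := GRing.Zmodule_isLmodule.Build R (realify L)
  rscaleA rscale1 rscaleDr rscaleDl.

Let e := vbasis {:L}.
Definition r2row (v : realify L) : 'rV[R]_(\dim {:L} + \dim {:L}) :=
  row_mx (map_mx (@complex.Re R) (rVof e (v : L)))
         (map_mx (@complex.Im R) (rVof e (v : L))).
Definition row2r (u : 'rV[R]_(\dim {:L} + \dim {:L})) : realify L :=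
  vecof e (\row_i (lsubmx u 0 i +i* rsubmx u 0 i)).

Fact realify_vect_axiom : Vector.axiom (\dim {:L} + \dim {:L}) (realify L).
Proof.
exists r2row.
  move=> a u v; rewrite /r2row.
  have -> : rVof e (a *: u + v : realify L) = a%:C *: rVof e (u : L) + rVof e (v : L).
    exact: (linearP (rVof e) a%:C (u : L) (v : L)).
  rewrite scale_row_mx add_row_mx; congr row_mx; apply/rowP => i; rewrite !mxE.
    by case: (coord _ _ u) (coord _ _ v) => [x y] [z t] /=; rewrite mul0r subr0.
  by case: (coord _ _ u) (coord _ _ v) => [x y] [z t] /=; rewrite mul0r addr0.
exists row2r => [v|u].
  rewrite /row2r /r2row row_mxKl row_mxKr -[RHS](rVofK (vbasisP {:L})).
  by congr vecof; apply/rowP => i; rewrite !mxE; case: (coord _ _ _).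
rewrite /row2r /r2row (vecofK (vbasisP {:L})) -[RHS]hsubmxK.
by congr row_mx; apply/rowP => i; rewrite !mxE.
Qed.

HB.instance Definition _ := Lmodule_hasFinDim.Build R (realify L) realify_vect_axiom.
End Realify.

Definition is_lie_bracket (K : fieldType) (L : vectType K)
    (br : {bilinear L -> L -> L}) : Prop :=
  (forall x, br x x = 0) /\
  (forall x y z, br x (br y z) + br y (br z x) + br z (br x y) = 0).

Section RealForm.
Variables (R : realType) (L : vectType R[i]).
Implicit Type gg : {vspace realify L}.

Definition is_real_form (br : {bilinear L -> L -> L}) gg : Prop :=
  [/\ {in gg &, forall x y : L, br x y \in gg},
      forall z : L, exists x y : L, [/\ x \in gg, y \in gg & z = x + 'i *: y]
    & forall x : L, x \in gg -> 'i *: x \in gg -> x = 0].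

(* [vsproj gg] is the identity on [gg], so on a subalgebra this is the bracket
   of the ambient algebra. *)
Definition restr_bracket (br : L -> L -> L) gg (x y : subvs_of gg) : subvs_of gg :=
  vsproj gg (br (vsval x) (vsval y)).

(* Equals the restriction itself once the latter is known to be real valued. *)
Definition restr_form (gC : L -> L -> R[i]) gg (x y : subvs_of gg) : R :=
  complex.Re (gC (vsval x) (vsval y)).
Arguments restr_form gC gg x y : clear implicits.

Section Instance.
Variables (gC : {symmetric L}) (gg : {vspace realify L}).

Let restr_formC (x y : subvs_of gg) : restr_form gC gg x y = restr_form gC gg y x.
Proof. by rewrite /restr_form hermitian_subproof /= expr0 mul1r. Qed.

Let restr_formE (x y : subvs_of gg) a z :
  restr_form gC gg z (a *: x + y) = a * restr_form gC gg z x + restr_form gC gg z y.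
Proof.
rewrite /restr_form [vsval (_ + _)]linearP /=.
have -> : gC (vsval z) (a *: vsval x + vsval y) =
          a%:C * gC (vsval z) (vsval x) + gC (vsval z) (vsval y).
  exact: (linearP (gC (vsval z : L)) a%:C (vsval x : L) (vsval y : L)).
by case: (gC _ (vsval x)) (gC _ (vsval y)) => [? ?] [? ?] /=; rewrite mul0r subr0.
Qed.

Fact restr_form_linearl (y : subvs_of gg) : linear_for *%R ((restr_form gC gg)^~ y).
Proof. by move=> a x x' /=; rewrite !(restr_formC _ y) restr_formE. Qed.

Fact restr_form_linearr (x : subvs_of gg) :
  linear_for (idfun \; *%R) (restr_form gC gg x).
Proof.
by move=> a y y' /=; rewrite restr_formE.
Qed.

Fact restr_form_herm (x y : subvs_of gg) :
  restr_form gC gg x y = (-1) ^+ false * idfun (restr_form gC gg y x).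
Proof. by rewrite expr0 mul1r restr_formC. Qed.

HB.instance Definition _ := bilinear_isBilinear.Build R
  (subvs_of gg) (subvs_of gg) R *%R (idfun \; *%R) (restr_form gC gg)
  (conj restr_form_linearl restr_form_linearr).
HB.instance Definition _ := isHermitianSesquilinear.Build R
  (subvs_of gg) false idfun (restr_form gC gg) restr_form_herm.
End Instance.

Definition is_real_slice (gC : {symmetric L}) gg : Prop :=
  {in gg &, forall x y : L, complex.Im (gC x y) = 0} /\
  nondegenerate (restr_form gC gg : {symmetric _}).
End RealForm.
Arguments restr_bracket {R L} br gg x y.
Arguments restr_form {R L} gC gg x y.

Section RealLie.
Variables (R : realType) (V : vectType R).
Implicit Types (br : V -> V -> V) (g : {symmetric V}).

Definition has_signature g (p q : nat) : Prop :=
  exists e : (p + q).-tuple V, basis_of {:V} e /\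
    forall i j : 'I_(p + q),
      g (tnth e i) (tnth e j) = if i == j then (-1) ^+ (p <= i)%N else 0.

Definition is_lie_morph br (f : 'End(V)) : Prop :=
  forall x y, f (br x y) = br (f x) (f y).

Definition lie_aut br : set 'End(V) :=
  [set f | lker f == 0%VS /\ is_lie_morph br f].

Definition isometry_group g : set 'End(V) :=
  [set f | lker f == 0%VS /\ isometry g g f].

(* Connected component of the identity in a set of endomorphisms, for the usual
   topology of the finite-dimensional space 'End(V), read off on matrices in a
   fixed basis of V. *)
Definition id_component (G : set 'End(V)) : set 'End(V) :=
  let mx : 'End(V) -> 'M[R]_(\dim {:V}) := mxof (vbasis {:V}) (vbasis {:V}) in
  [set f | connected_component (mx @` G) (mx \1%VF) (mx f)].

Definition is_cartan_involution br g (theta : 'End(V)) : Prop :=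
  [/\ is_lie_morph br theta,
      (theta \o theta)%VF = \1%VF,
      isometry g g theta
    & forall x, x != 0 -> 0 < g x (theta x)].
End RealLie.

(* Main.v *)
(** Put [N = theta1 \o theta2].  With respect to the inner product
    [g (_, theta1 _)] it is self-adjoint and positive, so it is diagonalizable
    with positive eigenvalues and its real powers [N^t] make sense.  As [N] is
    an automorphism and an isometry of [g], so is every [N^t], and
    [t |-> N^t] is a continuous path from the identity.  Since
    [theta1 N^t = N^-t theta1], the power [phi = N^(-1/2)] satisfies
    [phi theta1 phi^-1 = N^-1 theta1 = theta1 N = theta2]. *)
Require Import Defs.
From HB Require Import structures.
From mathcomp Require Import all_boot all_order all_algebra.
From mathcomp Require Import all_classical all_reals all_analysis.
From mathcomp Require Import complex.
From mathcomp Require Import mxpoly zify lra.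
Set Implicit Arguments. Unset Strict Implicit. Unset Printing Implicit Defensive.
Import Order.TTheory GRing.Theory Num.Theory.
Import numFieldNormedType.Exports.
Local Open Scope classical_set_scope.
Local Open Scope ring_scope.
Local Open Scope complex_scope.
Import passmx.

(** * Self-adjoint matrices: real spectrum and diagonalizability *)

Section SelfAdjointMatrix.
Variables (R : rcfType) (n : nat) (M H : 'M[R]_n).
Hypothesis Hpos : forall u : 'rV[R]_n, u != 0 -> 0 < (u *m H *m u^T) 0 0.
Hypothesis MH : M *m H = H *m M^T.

Lemma posdef_eq0 (u : 'rV[R]_n) : (u *m H *m u^T) 0 0 = 0 -> u = 0.
Proof. by move=> u0; apply/eqP/negPn/negP => /Hpos; rewrite u0 ltxx. Qed.

Lemma posdef_ge0 (u : 'rV[R]_n) : 0 <= (u *m H *m u^T) 0 0.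
Proof. by have [->|/Hpos/ltW//] := eqVneq u 0; rewrite !mul0mx mxE. Qed.

(** Vectors are rows on which [M] acts from the right, so [MH] expresses self-adjointness for the
    form of [H]. *)
Lemma selfadjoint_formE (u w : 'rV[R]_n) : (u *m M) *m H *m w^T = u *m H *m (w *m M)^T.
Proof. by rewrite trmx_mul -(mulmxA u) MH !mulmxA. Qed.

(** Write an eigenvector for a + ib as x + iy. Evaluating the form h of [H] on (xM, y) and on (x,
    yM) gives b (h(x,x) + h(y,y)) = 0, and positivity forces b = 0. *)
Lemma selfadjoint_root_real (z : R[i]) :
  root (map_poly (real_complex R) (char_poly M)) z -> complex.Im z = 0.
Proof.
rewrite map_char_poly -eigenvalue_root_char => /eigenvalueP[v vM v0].
pose x := map_mx (@complex.Re R) v; pose y := map_mx (@complex.Im R) v.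
case: z vM => a b vM /=.
have vE : v = map_mx (real_complex R) x + 'i *: map_mx (real_complex R) y.
  by apply/rowP => j; rewrite !mxE [LHS]complexE.
rewrite vE mulmxDl -scalemxAl -!map_mxM in vM.
have xM : x *m M = a *: x - b *: y.
  apply/rowP => j; move/rowP/(_ j): vM; rewrite !mxE /=.
  by set s := \sum_i _; set t := \sum_i _; case: (v 0 j) => c d /=; simpc => -[-> _].
have yM : y *m M = a *: y + b *: x.
  apply/rowP => j; move/rowP/(_ j): vM; rewrite !mxE /=.
  by set s := \sum_i _; set t := \sum_i _; case: (v 0 j) => c d /=; simpc => -[_ ->].
have := selfadjoint_formE x y.
have -> : (y *m M)^T = a *: y^T + b *: x^T by rewrite yM linearD !linearZ.
rewrite xM !mulmxDl !mulmxDr.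
rewrite !mulNmx -!scalemxAl -!scalemxAr => /addrI/matrixP/(_ 0 0).
rewrite [LHS]mxE [X in - X]mxE [RHS]mxE.
have := posdef_ge0 x; have := posdef_ge0 y.
set hx := (x *m H *m x^T) 0 0; set hy := (y *m H *m y^T) 0 0 => hy0 hx0 e.
apply/eqP; apply: contraT => b0.
have hxy : hx + hy = 0 by apply: (mulfI b0); rewrite mulr0 mulrDr -e addNr.
have hx00 : hx = 0 by lra.
have hy00 : hy = 0 by lra.
move: v0; rewrite vE (posdef_eq0 hx00) (posdef_eq0 hy00).
by rewrite !map_mx0 scaler0 addr0 eqxx.
Qed.
End SelfAdjointMatrix.

(** The polynomial splits over the algebraically closed field R[i]; its roots there equal their real
    parts, so the factorization descends to R. *)
Lemma char_poly_selfadjoint_split (R : rcfType) n (M H : 'M[R]_n) :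
  (forall u : 'rV[R]_n, u != 0 -> 0 < (u *m H *m u^T) 0 0) ->
  M *m H = H *m M^T ->
  exists rs : seq R, char_poly M = \prod_(a <- rs) ('X - a%:P).
Proof.
move=> Hp MH.
have [zs zsE] := closed_field_poly_normal (map_poly (real_complex R) (char_poly M)).
rewrite lead_coef_map (monicP (char_poly_monic M)) rmorph1 scale1r in zsE.
exists (map (@complex.Re R) zs).
apply: (map_poly_inj (real_complex R)); rewrite zsE rmorph_prod big_map.
apply: eq_big_seq => z zz; rewrite rmorphB /= map_polyX map_polyC /=.
congr (_ - _%:P); rewrite [LHS]complexE (selfadjoint_root_real Hp MH (z := z)).
  by rewrite mulr0 addr0.
by rewrite zsE root_prod_XsubC.
Qed.

Lemma perm_not_uniq (T : eqType) (s : seq T) :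
  ~~ uniq s -> exists x t, perm_eq s [:: x, x & t].
Proof.
elim: s => // y s IH; rewrite [uniq _]/= negb_and negbK.
case/orP => [ys|/IH[x [t st]]].
  by exists y, (rem y s); rewrite perm_cons perm_to_rem.
exists x, (y :: t); apply: (@perm_trans _ (y :: [:: x, x & t])).
  by rewrite perm_cons.
by apply/permP => P /=; lia.
Qed.

(** The minimal polynomial splits, as it divides the characteristic one; it remains to refute a
    repeated root. *)
Lemma selfadjoint_diagonalizable (R : rcfType) n (M H : 'M[R]_n) :
  (forall u : 'rV[R]_n, u != 0 -> 0 < (u *m H *m u^T) 0 0) ->
  M *m H = H *m M^T -> diagonalizable M.
Proof.
case: n M H => [|n] M H Hp MH; first by rewrite [M]thinmx0; exact: diagonalizable0.
apply/diagonalizableP.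
have [rs rsE] := char_poly_selfadjoint_split Hp MH.
have := mxminpoly_dvd_char M; rewrite rsE => /dvdp_prod_XsubC[m].
rewrite eqp_monic ?mxminpoly_monic ?monic_prod_XsubC// => /eqP minE.
exists (mask m rs); last by rewrite minE.
move: (mask m rs) minE => {}rs {m rsE} minE; rewrite -[uniq _]negbK; apply/negP.
move=> /perm_not_uniq[a [rs' rsE]].
pose q := \prod_(c <- rs') ('X - c%:P).
have minq : mxminpoly M = ('X - a%:P) ^+ 2 * q.
  by rewrite minE (perm_big _ rsE) !big_cons expr2 -mulrA.
(* Self-adjointness gives [ker (M - a)^2 = ker (M - a)], so one factor of
   ['X - a] can be dropped from the minimal polynomial. *)
have : horner_mx M (('X - a%:P) * q) = 0.
  apply/row_matrixP => k; rewrite row0 rowE; set w := delta_mx _ _.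
  rewrite mulrC rmorphM /= mulmxA; set u := w *m _.
  have : u *m horner_mx M ('X - a%:P) *m horner_mx M ('X - a%:P) = 0.
    by rewrite /u -!mulmxA !mulmxE -!rmorphM /= mulrC -expr2 -minq mx_root_minpoly mulmx0.
  rewrite rmorphB /= horner_mx_X horner_mx_C !mulmxBr !mul_mx_scalar.
  (* With h the form of [H], h(t,t) = h(u, tM - at) = 0, so t vanishes by definiteness. *)
  set t := u *m M - a *: u => tM; apply: (posdef_eq0 Hp).
  have {tM}tM : t *m M = a *: t by apply/eqP; rewrite -subr_eq0 tM.
  rewrite [in X in X *m _ *m _]/t mulmxBl mulmxBl (selfadjoint_formE MH) tM.
  by rewrite -!scalemxAl linearZ -scalemxAr subrr mxE.
(* The annihilating polynomial has degree one less than the minimal one. *)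
move/mxminpoly_min; rewrite minq exprS expr1 -mulrA.
have q0 : q != 0.
  by apply/eqP => q0; move: (mxminpoly_monic M); rewrite minq q0 mulr0 monicE lead_coef0
    eq_sym oner_eq0.
move/(dvdp_leq _); rewrite mulf_neq0 ?polyXsubC_eq0// => /(_ isT).
rewrite size_monicM ?monicXsubC ?mulf_neq0 ?polyXsubC_eq0// size_XsubC.
by rewrite ltnn.
Qed.

(** * Eigenbases of diagonalizable and self-adjoint endomorphisms *)

Lemma diagonalizable_eigenbasis (F : fieldType) (V : vectType F) (N : 'End(V)) :
  diagonalizable (mxof (vbasis {:V}) (vbasis {:V}) N) ->
  exists (b : (\dim {:V}).-tuple V) (d : 'I_(\dim {:V}) -> F),
    basis_of {:V} b /\ forall i : 'I_(\dim {:V}), N b`_i = d i *: b`_i.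
Proof.
set e := vbasis {:V}; set M := mxof e e N => -[P Pu].
have eb : basis_of {:V} e := vbasisP _.
case/(diagonalizable_forLR Pu) => D ME.
(* The rows of [P] are left eigenvectors of [M], hence coordinates of eigenvectors of [N]. *)
pose b := [tuple vecof e (row i P) | i < \dim {:V}].
have bE (i : 'I_(\dim {:V})) : b`_i = vecof e (row i P).
  by rewrite -tnth_nth tnth_mktuple.
exists b, (fun i => D 0 i); split=> [|i].
  rewrite basisEdim size_tuple leqnn andbT; apply/subvP => v _.
  rewrite -(rVofK eb v) -[rVof e v](mulmxKV Pu).
  set u := _ *m invmx P; rewrite mulmx_sum_row linear_sum memv_suml// => i _.
  by rewrite linearZ memvZ//= -bE memv_span// mem_nth ?size_tuple.
rewrite bE (hom_vecof e eb) -/M ME -linearZ; congr vecof.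
by rewrite conjVmx// !mulmxA -row_mul mulmxV// row1 -rowE row_diag_mx -scalemxAl -rowE.
Qed.

(** The Gram matrix of [h] in a fixed basis reduces the claim to matrices. [h] is a bare function so
    that [fun x y => g x (theta1 y)] fits directly. *)
Lemma selfadjoint_eigenbasis (R : rcfType) (V : vectType R) (h : V -> V -> R) (N : 'End(V)) :
  (forall y, scalar (h^~ y)) -> (forall x y, h x y = h y x) ->
  (forall x, x != 0 -> 0 < h x x) -> (forall x y, h (N x) y = h x (N y)) ->
  exists (b : (\dim {:V}).-tuple V) (d : 'I_(\dim {:V}) -> R),
    basis_of {:V} b /\ forall i : 'I_(\dim {:V}), N b`_i = d i *: b`_i.
Proof.
move=> hl hC hpos hN; apply: diagonalizable_eigenbasis.
set e := vbasis {:V}; set M := mxof e e N.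
have eb : basis_of {:V} e := vbasisP _.
have h0 y : h 0 y = 0 by have := hl y (-1) 0 0; rewrite scaler0 addr0 mulN1r addNr.
have hsum y (I : finType) (F : I -> V) : h (\sum_i F i) y = \sum_i h (F i) y.
  elim/big_rec2: _ => // i x s _ <-; by have := hl y 1 (F i) s; rewrite scale1r mul1r.
have hZ a x y : h (a *: x) y = a * h x y.
  by have := hl y a x 0; rewrite !addr0 h0 addr0.
pose H : 'M[R]_(\dim {:V}) := \matrix_(i, j) h e`_i e`_j.
have HE u w : (u *m H *m w^T) 0 0 = h (vecof e u) (vecof e w).
  rewrite /vecof hsum !mxE; under eq_bigr do rewrite mxE mulr_suml.
  rewrite exchange_big /=; apply: eq_bigr => i _; rewrite hZ hC hsum mulr_sumr.
  by apply: eq_bigr => j _; rewrite !mxE hZ hC mulrAC mulrA.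
apply: (@selfadjoint_diagonalizable _ _ _ H).
- by move=> u u0; rewrite HE hpos// vecof_eq0.
- apply/matrixP => i j.
  have mxij (A : 'M[R]_(\dim {:V})) : A i j =
      ((delta_mx 0 i : 'rV_(\dim {:V})) *m A *m (delta_mx 0 j : 'rV_(\dim {:V}))^T) 0 0.
    by rewrite trmx_delta -colE -rowE !mxE.
  rewrite [LHS]mxij [RHS]mxij -!mulmxA (mulmxA _ M) (mulmxA _ H) -trmx_mul.
  by rewrite mulmxA !HE -!(hom_vecof e eb).
Qed.

(** The scaling law [s] is arbitrary so that both vector-valued and scalar-valued maps are covered;
    brackets and forms are compared one argument at a time. *)
Lemma linear_basis_ext (F : fieldType) (V : vectType F) (W : zmodType)
    (s : GRing.Scale.law F W) (b : (\dim {:V}).-tuple V) (f h : {linear V -> W | s}) :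
  basis_of {:V} b -> (forall i : 'I_(\dim {:V}), f b`_i = h b`_i) -> f =1 h.
Proof.
move=> bb fh x; rewrite (coord_basis bb (memvf x)) !linear_sum.
by apply: eq_bigr => i _; rewrite !linearZ fh.
Qed.

Lemma continuous_powRr (R : realType) (a : R) : 0 < a -> continuous (fun t : R => a `^ t).
Proof.
move=> a0.
rewrite (_ : (fun t : R => a `^ t) = expR \o *%R^~ (ln a)); last first.
  by apply/funext => t /=; rewrite /powR gt_eqF.
move=> t; apply: continuous_comp; [exact: mulrr_continuous | exact: continuous_expR].
Qed.

(** * Real powers of a diagonalizable endomorphism with positive eigenvalues *)

Section EigenPower.
Variables (R : realType) (V : vectType R) (N : 'End(V)).
Variables (b : (\dim {:V}).-tuple V) (d : 'I_(\dim {:V}) -> R).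
Hypothesis bb : basis_of {:V} b.
Hypothesis Nb : forall i : 'I_(\dim {:V}), N b`_i = d i *: b`_i.
Hypothesis d0 : forall i, 0 < d i.

(** This is N^t: each matrix unit gives the projection onto a basis line. Only the scalar
    coefficients depend on t, which makes continuity easy. *)
Definition eigenpow (t : R) : 'End(V) :=
  \sum_i d i `^ t *: hommx b b (delta_mx i i).

Lemma eigenpow_coord t x :
  eigenpow t x = \sum_i (coord b i x * d i `^ t) *: b`_i.
Proof.
rewrite sum_lfunE; apply: eq_bigr => i _.
have E : rVof b x *m delta_mx i i = coord b i x *: delta_mx 0 i.
  rewrite -(mul_delta_mx (0 : 'I_1)) mulmxA -colE.
  by rewrite [col _ _]mx11_scalar mul_scalar_mx !mxE.
by rewrite scale_lfunE (hommxE bb bb) E linearZ /= vecof_delta scalerA mulrC.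
Qed.

Lemma coord_eigen i x : coord b i (N x) = d i * coord b i x.
Proof.
rewrite [in LHS](coord_basis bb (memvf x)) !linear_sum /= (bigD1 i)//=.
rewrite linearZ /= Nb !linearZ /= coord_free ?(basis_free bb)// eqxx mulr1 mulrC.
rewrite big1 ?addr0// => j ji.
rewrite linearZ /= Nb !linearZ /= coord_free ?(basis_free bb)//.
by rewrite (negPf (ji : j != i)) !mulr0.
Qed.

(** The coordinates of x vanish wherever d_i differs from a. General x is needed because brackets of
    basis vectors and their images under [theta] need not be basis vectors. *)
Lemma eigenpow_eigen t a x : 0 < a -> N x = a *: x -> eigenpow t x = a `^ t *: x.
Proof.
move=> a0 Nx; rewrite eigenpow_coord [x in RHS](coord_basis bb (memvf x)) scaler_sumr.
apply: eq_bigr => i _; rewrite scalerA; congr (_ *: _).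
have := coord_eigen i x; rewrite Nx linearZ /= => /eqP.
rewrite -subr_eq0 -mulrBl mulf_eq0 subr_eq0.
by case/orP => /eqP -> //; rewrite ?mulr0 ?mul0r// mulrC.
Qed.

Lemma eigenpow_basis t (i : 'I_(\dim {:V})) : eigenpow t b`_i = d i `^ t *: b`_i.
Proof. exact: eigenpow_eigen. Qed.

Lemma eigenpowD s t : (eigenpow s \o eigenpow t)%VF = eigenpow (s + t).
Proof.
apply/lfunP; apply: (linear_basis_ext bb) => i /=.
rewrite comp_lfunE !eigenpow_basis linearZ /= eigenpow_basis scalerA.
by rewrite -powRD 1?addrC// (gt_eqF (d0 i)) implybT.
Qed.

Lemma eigenpow0 : eigenpow 0 = \1%VF.
Proof.
apply/lfunP; apply: (linear_basis_ext bb) => i /=.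
by rewrite eigenpow_basis powRr0 scale1r id_lfunE.
Qed.

Lemma eigenpow1 : eigenpow 1 = N.
Proof.
apply/lfunP; apply: (linear_basis_ext bb) => i /=.
by rewrite eigenpow_basis powRr1 ?ltW// Nb.
Qed.

Lemma lker_eigenpow t : lker (eigenpow t) == 0%VS.
Proof.
apply/lker0P; apply: (can_inj (g := eigenpow (- t))) => x.
by rewrite -comp_lfunE eigenpowD addNr eigenpow0 id_lfunE.
Qed.

Lemma eigenpowV t : (eigenpow t)^-1%VF = eigenpow (- t).
Proof.
rewrite -[RHS]comp_lfun1l -(lker0_compVf (lker_eigenpow t)).
by rewrite -comp_lfunA eigenpowD subrr eigenpow0 comp_lfun1r.
Qed.

(** On basis vectors (d_i d_j - 1) g(b_i, b_j) = 0, so either g(b_i, b_j) = 0 or d_i d_j = 1, and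
    then (d_i d_j)^t = 1. *)
Lemma eigenpow_isometry (g : {symmetric V}) t : isometry g g N -> isometry g g (eigenpow t).
Proof.
move=> gN x y.
apply: (@linear_basis_ext _ _ _ _ _ (applyr g (eigenpow t y) \o eigenpow t) (applyr g y) bb) => i /=.
apply: (@linear_basis_ext _ _ _ _ _ (g (eigenpow t b`_i) \o eigenpow t) (g b`_i) bb) => j /=.
rewrite !eigenpow_basis linearZl_LR linearZr_LR /= mulrA -powRM ?ltW//.
have := gN b`_i b`_j; rewrite !Nb linearZl_LR linearZr_LR /= mulrA => /eqP.
rewrite -subr_eq0 -{2}[g _ _]mul1r -mulrBl mulf_eq0 subr_eq0.
by case/orP => /eqP ->; rewrite ?mulr0// powR1 mul1r.
Qed.

(** N scales the bracket of b_i and b_j by d_i d_j, hence N^t scales it by (d_i d_j)^t = d_i^t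
    d_j^t. *)
Lemma eigenpow_morph (br : {bilinear V -> V -> V}) t :
  is_lie_morph br N -> is_lie_morph br (eigenpow t).
Proof.
move=> brN x y.
apply: (@linear_basis_ext _ _ _ _ _ (eigenpow t \o applyr br y)
  (applyr br (eigenpow t y) \o eigenpow t) bb) => i /=.
apply: (@linear_basis_ext _ _ _ _ _ (eigenpow t \o br b`_i)
  (br (eigenpow t b`_i) \o eigenpow t) bb) => j /=.
rewrite !eigenpow_basis linearZl_LR linearZr_LR /= scalerA -powRM ?ltW//.
apply: eigenpow_eigen; first by rewrite mulr_gt0.
by rewrite brN !Nb linearZl_LR linearZr_LR /= scalerA.
Qed.

(** By hypothesis N scales the image of b_i under [theta] by 1/d_i, and (1/d_i)^(-t) = d_i^t. *)
Lemma eigenpow_inverse_conj (theta : 'End(V)) t :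
  (N \o theta \o N = theta)%VF -> (theta \o eigenpow t = eigenpow (- t) \o theta)%VF.
Proof.
move=> NtN; apply/lfunP; apply: (linear_basis_ext bb) => i /=.
rewrite !comp_lfunE eigenpow_basis linearZ /=.
rewrite (@eigenpow_eigen _ (d i)^-1) ?invr_gt0//.
  by rewrite -[(d i)^-1]powR_inv1 ?ltW// -powRrM mulN1r opprK.
have /lfunP/(_ b`_i) := NtN; rewrite !comp_lfunE Nb !linearZ /= => e.
by rewrite -[in RHS]e scalerA mulVf ?scale1r// gt_eqF.
Qed.

(** The image of the real line under t |-> N^t is a connected part of [G], with the identity at t =
    0. *)
Lemma id_component_eigenpow (G : set 'End(V)) s :
  (forall t, G (eigenpow t)) -> id_component G (eigenpow s).
Proof.
move=> Gpow; pose mx := mxof (vbasis {:V}) (vbasis {:V}).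
exists ((mx \o eigenpow) @` setT); last by exists s.
split; first by exists 0; rewrite //= eigenpow0.
  by move=> _ [t _ <-]; exists (eigenpow t).
apply: connected_continuous_connected.
  by apply/connected_intervalP.
apply: continuous_subspaceT.
rewrite (_ : _ \o _ = fun t => \sum_i d i `^ t *: mx (hommx b b (delta_mx i i))); last first.
  apply/funext => u /=; rewrite /mx /eigenpow linear_sum.
  by apply: eq_bigr => i _; rewrite linearZ.
apply: continuous_big => [|i _]; first exact: add_continuous.
by move=> t; apply: continuousZr_tmp; exact: continuous_powRr.
Qed.
End EigenPower.

(** * Conjugacy of two Cartan involutions over the reals *)

Lemma cartan_involution_conj (R : realType) (V : vectType R)
    (br : {bilinear V -> V -> V}) (g : {symmetric V}) (theta1 theta2 : 'End(V)) :
  is_cartan_involution br g theta1 -> is_cartan_involution br g theta2 ->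
  exists phi : 'End(V),
    (id_component (lie_aut br) `&` id_component (isometry_group g)) phi /\
    theta2 = (phi \o theta1 \o phi^-1)%VF.
Proof.
move=> [m1 /lfunP i1 g1 p1] [m2 /lfunP i2 g2 p2].
have {}i1 x : theta1 (theta1 x) = x by have := i1 x; rewrite comp_lfunE id_lfunE.
have {}i2 x : theta2 (theta2 x) = x by have := i2 x; rewrite comp_lfunE id_lfunE.
have gC x y : g x y = g y x by rewrite hermitian_subproof /= expr0 mul1r.
(* An involutive isometry is its own adjoint for [g]. *)
have g1C x y : g (theta1 x) y = g x (theta1 y) by rewrite -g1 i1.
have g2C x y : g (theta2 x) y = g x (theta2 y) by rewrite -g2 i2.
pose N := (theta1 \o theta2)%VF.
have [||||b [d [bb Nb]]] := @selfadjoint_eigenbasis R V (fun x y => g x (theta1 y)) N.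
- by move=> y a u v; rewrite linearDl linearZl_LR.
- by move=> x y; rewrite -g1C gC.
- exact: p1.
- by move=> x y; rewrite !comp_lfunE g1 i1 g2C.
have d0 i : 0 < d i.
  have bi0 : b`_i != 0.
    by apply: (free_not0 (basis_free bb)); rewrite mem_nth ?size_tuple.
  (* This value equals g(theta2 b_i, b_i), and also d_i g(b_i, theta1 b_i). *)
  have : 0 < g (N b`_i) (theta1 b`_i) by rewrite comp_lfunE g1 gC p2.
  by rewrite Nb linearZl_LR /= pmulr_lgt0 ?p1.
have mN : is_lie_morph br N by move=> x y; rewrite !comp_lfunE m2 m1.
have gN : isometry g g N by move=> x y; rewrite !comp_lfunE g1 g2.
have NtN : (N \o theta1 \o N = theta1)%VF.
  by apply/lfunP => x; rewrite !comp_lfunE i1 i2.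
(* For phi = N^s the conjugate of theta1 is N^(2s) theta1, which has to be N^-1 theta1 = theta2. *)
exists (eigenpow b d (- 2^-1)); split.
  have ker t := lker_eigenpow bb Nb d0 t.
  split; apply: (id_component_eigenpow bb Nb d0) => t; split; try exact: ker.
    exact: (eigenpow_morph bb Nb d0 (br := br) t mN).
  exact: (eigenpow_isometry bb Nb d0 (g := g) t gN).
rewrite (eigenpowV bb Nb d0) opprK -comp_lfunA (eigenpow_inverse_conj bb Nb d0)//.
rewrite comp_lfunA (eigenpowD bb Nb d0) (_ : _ + _ = - 1); last lra.
rewrite -(eigenpow_inverse_conj bb Nb d0)// (eigenpow1 bb Nb d0).
by apply/lfunP => x; rewrite !comp_lfunE i1.
Qed.

(** * Real bilinearity of the restricted bracket *)

Section RestrBracket.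
Variables (R : realType) (L : vectType R[i]) (br : {bilinear L -> L -> L}).
Variable gg : {vspace realify L}.

Fact restr_bracket_linearl (y : subvs_of gg) : linear ((restr_bracket br gg)^~ y).
Proof.
move=> a u v; rewrite /restr_bracket -linearP; congr (vsproj gg _).
rewrite [vsval (_ + _)]linearP /=.
(* Scaling by a in [realify L] is scaling by [a%:C] in [L], so complex linearity applies. *)
exact: (linearP (applyr br (vsval y : L)) a%:C (vsval u : L) (vsval v : L)).
Qed.

Fact restr_bracket_linearr (x : subvs_of gg) : linear (restr_bracket br gg x).
Proof.
move=> a u v; rewrite /restr_bracket -linearP; congr (vsproj gg _).
rewrite [vsval (_ + _)]linearP /=.
exact: (linearP (br (vsval x : L)) a%:C (vsval u : L) (vsval v : L)).
Qed.

HB.instance Definition _ := bilinear_isBilinear.Build R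
  (subvs_of gg) (subvs_of gg) (subvs_of gg) *:%R *:%R (restr_bracket br gg)
  (conj restr_bracket_linearl restr_bracket_linearr).
End RestrBracket.

Theorem corollary4p1 (R : realType) (L : vectType R[i])
    (br : {bilinear L -> L -> L}) (hbr : is_lie_bracket br)
    (gC : {symmetric L}) (hgC : nondegenerate gC)
    (gg : {vspace realify L})
    (hform : is_real_form br gg) (hslice : is_real_slice gC gg)
    (p q : nat) (hpq : has_signature (restr_form gC gg) p q)
    (theta1 theta2 : 'End(subvs_of gg))
    (h1 : is_cartan_involution (restr_bracket br gg) (restr_form gC gg) theta1)
    (h2 : is_cartan_involution (restr_bracket br gg) (restr_form gC gg) theta2) :
  exists phi : 'End(subvs_of gg),
    (id_component (lie_aut (restr_bracket br gg)) `&`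
     id_component (isometry_group (restr_form gC gg))) phi /\
    theta2 = (phi \o theta1 \o phi^-1)%VF.
Proof. exact: (cartan_involution_conj h1 h2). Qed.
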